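(* Let $A$ and $B$ denote a $d\times 2d$ real equiangular tight frame and its Naimark complement, respectively, and let $\theta$ denote any odd multiple of $\pi/8$. Then the $2d\times4d$ matrix \[ \Phi=\begin{bmatrix} A\cos\theta & -A\sin\theta\\ B\sin\theta & B\cos\theta\end{bmatrix} \] is an orthobiangular tight frame, and it is a strongly locally optimal $4d$-packing in $\mathbb{R}\mathbf{P}^{2d-1}$.
   Context: An $n$-packing in $\mathbb{R}\mathbf{P}^{d-1}$ is a sequence $\Phi=\{\varphi_i\}_{i=1}^n$ of $n$ unit vectors in $\mathbb{R}^d$, identified with the $d\times n$ matrix whose columns are these vectors. A packing is a tight frame if $\Phi\Phi^\top=(n/d)I$. A $d\times n$ equiangular tight frame (ETF) is a $d\times n$ matrix $\Phi$ with unit-norm columns satisfying $\Phi\Phi^\top=(n/d)I$ such that $|\langle\varphi_i,\varphi_j\rangle|$ is the same for all $i\ne j$. A packing is orthobiangular if there is $\beta\ge0$ such that every off-diagonal entry of its Gram matrix $\Phi^\top\Phi$ lies in $\{0,\beta,-\beta\}$. A Naimark complement of a $d\times n$ tight frame $\Phi$ is the $(n-d)\times n$ matrix whose rows complete the (orthogonal, equal-norm) rows of $\Phi$ to an equal-norm orthogonal basis of $\mathbb{R}^n$; in particular for a $d\times 2d$ ETF $A$, a Naimark complement is a $d\times2d$ matrix $B$ with $BB^\top=2I$, $AB^\top=0$ (equivalently, $A^\top A+B^\top B=2I$), and it has unit-norm columns. Let \[ \mathcal{M}_d^n=\{G\in\mathbb{R}^{n\times n}: G^\top=G,\ \operatorname{diag}(G)=\mathbf{1},\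 G\succeq0,\ \operatorname{rank}(G)=d\}, \] and let $\|\cdot\|_\infty$ be the entrywise max norm. An $n$-packing in $\mathbb{R}\mathbf{P}^{d-1}$ with Gram matrix $G$ is strongly locally optimal if $G\in\mathcal{M}_d^n$ and there is a neighborhood $\mathcal{N}$ of $G$ in $\mathbb{R}^{n\times n}$ such that $\|X-I\|_\infty>\|G-I\|_\infty$ for every $X\in\mathcal{M}_d^n\cap\mathcal{N}\setminus\{G\}$. *)

(* Defs.v *)
From HB Require Import structures.
From mathcomp Require Import all_boot all_order all_algebra.
From mathcomp Require Import all_classical all_reals all_analysis.

Set Implicit Arguments.
Unset Strict Implicit.
Unset Printing Implicit Defensive.

Import Order.TTheory GRing.Theory Num.Theory.
Import numFieldNormedType.Exports.

Local Open Scope classical_set_scope.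
Local Open Scope ring_scope.

(* A packing of n points of RP^(d-1) is a d x n matrix whose columns are unit
   representatives of the points. *)

Definition gram (R : realType) (d n : nat) (Phi : 'M[R]_(d, n)) : 'M[R]_n :=
  Phi^T *m Phi.

Definition is_packing (R : realType) (d n : nat) (Phi : 'M[R]_(d, n)) : Prop :=
  forall j, \sum_i Phi i j ^+ 2 = 1.

Definition is_tight_frame (R : realType) (d n : nat) (Phi : 'M[R]_(d, n)) :
    Prop :=
  is_packing Phi /\ Phi *m Phi^T = (n%:R / d%:R)%:M.

Definition is_ETF (R : realType) (d n : nat) (Phi : 'M[R]_(d, n)) : Prop :=
  is_tight_frame Phi /\
  forall i j k l, i != j -> k != l -> `|gram Phi i j| = `|gram Phi k l|.

Definition is_orthobiangular (R : realType) (d n : nat) (Phi : 'M[R]_(d, n)) :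
    Prop :=
  is_packing Phi /\
  exists2 beta : R, 0 <= beta &
    forall i j, i != j ->
      [\/ gram Phi i j = 0, gram Phi i j = beta | gram Phi i j = - beta].

(* The rows of U form an orthogonal basis of R^n with all norms equal; being a
   basis forces m = n. *)
Definition equal_norm_orthogonal_basis (R : realType) (m n : nat)
    (U : 'M[R]_(m, n)) : Prop :=
  [/\ row_free U /\ row_full U,
      forall i j, i != j -> (U *m U^T) i j = 0
    & forall i j, (U *m U^T) i i = (U *m U^T) j j].

(* The number of rows k of B is necessarily n - d. *)
Definition is_naimark_complement (R : realType) (d k n : nat)
    (A : 'M[R]_(d, n)) (B : 'M[R]_(k, n)) : Prop :=
  equal_norm_orthogonal_basis (col_mx A B).

Definition positive_semidefinite (R : realType) (n : nat) (G : 'M[R]_n) :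
    Prop :=
  forall x : 'cV[R]_n, 0 <= (x^T *m G *m x) 0 0.

Definition gram_set (R : realType) (d n : nat) : set 'M[R]_n :=
  [set G | [/\ G^T = G, forall i, G i i = 1, positive_semidefinite G
             & \rank G = d]].
Arguments gram_set R d n : clear implicits.

(* The norm on matrices is the entrywise max norm (mx_norm), and nbhs G is the
   filter of neighborhoods of G in the space of all n x n matrices. *)
Definition strongly_locally_optimal (R : realType) (d n : nat)
    (Phi : 'M[R]_(d, n)) : Prop :=
  let G := gram Phi in
  [/\ is_packing Phi, gram_set R d n G
    & exists2 N : set 'M[R]_n, nbhs G N &
        forall X, ((gram_set R d n `&` N) `\ G) X ->
          `|X - 1%:M| > `|G - 1%:M|].

(* Main.v *)
Require Import Defs.
From HB Require Import structures.
From mathcomp Require Import all_boot all_order all_algebra.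
From mathcomp Require Import all_classical all_reals all_analysis.
From mathcomp Require Import ring lra.

Set Implicit Arguments.
Unset Strict Implicit.
Unset Printing Implicit Defensive.

Import Order.TTheory GRing.Theory Num.Theory.
Import numFieldNormedType.Exports.

Local Open Scope ring_scope.

(** Put [C = A^T A - I].  Since [A] is an ETF, [C] is a symmetric involution
    with zero diagonal whose off-diagonal entries all have the same modulus
    [mu > 0].  The Naimark relation [A^T A + B^T B = 2 I] turns the Gram matrix
    of the rotated frame into
      [G = [[I + a C, - b C], [- b C, I - a C]]],
    with [a = cos 2theta] and [b = sin 2theta] ([gram_rotated_frame]).  At odd
    multiples of [pi / 8] one has [a^2 = b^2 = 1/2], so every off-diagonal
    entry of [G] is [0] or has modulus [beta = |a| mu], and the zeros are
    exactly the pairs [(i, n + i)] and [(n + i, i)], where [n = 2 d].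
    Tightness is [G^2 = 2 G]; hence [K = I - G / 2] is the orthogonal projection
    onto the kernel of [G].

    For local optimality, let [X = G + E] be a competitor of rank [2 d] with
    [|X - I| <= |G - I|].  The compression [K E K] of the perturbation to the
    kernel of [G] is estimated in two opposite ways.

    The rank forces [K E K] to be of second order: a matrix of rank [2 d] close
    to [G] is a graph over the range of [G], whose block on the kernel is
    quadratic in the off-diagonal block ([compression_quadratic]).

    Conversely [K E K] controls [E] linearly ([biangular_gram_rigid]).  At an
    entry with [|G i j| = beta], the constraint gives [E i j * G i j <= 0], and
    the trace of [K E K] is [- 1/2] times the sum of all [E i j * G i j]; these
    terms cannot cancel, so each such [E i j] is bounded by the trace
    ([contact_entry_bound]).  What is left of [E] lives on the zeros of [G] and
    is given by a diagonal matrix [D]; the corresponding diagonal entries of the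
    compression are exactly [D i i / 4], because [a^2 = b^2]
    ([compression_orthogonal_pair]).

    Both estimates together give [|E| <= c |E|^2], so [E = 0] once [E] is small
    ([isolated_of_linear_bound]). *)

(** * The entrywise max norm and matrix products *)

Lemma entry_le_mx_norm (R : realType) m n (A : 'M[R]_(m, n)) i j :
  `|A i j| <= `|A|.
Proof. by rewrite [leRHS]mx_normrE; apply: (le_bigmax _ _ (i, j)). Qed.

Lemma mx_norm_le (R : realType) m n (A : 'M[R]_(m, n)) e :
  0 <= e -> (forall i j, `|A i j| <= e) -> `|A| <= e.
Proof. by move=> e0 Ae; rewrite [leLHS]mx_normrE; apply: bigmax_le. Qed.

Lemma mx_norm_mul_le (R : realType) m n p
    (A : 'M[R]_(m, n)) (B : 'M[R]_(n, p)) :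
  `|A *m B| <= n%:R * (`|A| * `|B|).
Proof.
apply: mx_norm_le => [|i j]; first by rewrite !mulr_ge0.
rewrite mxE (le_trans (ler_norm_sum _ _ _))//.
rewrite (le_trans (ler_sum _ (G := fun=> `|A| * `|B|) _))//.
  by move=> k _; rewrite normrM ler_pM// entry_le_mx_norm.
by rewrite sumr_const card_ord mulr_natl.
Qed.

Lemma mx_norm_mul3_le (R : realType) m n p q
    (A : 'M[R]_(m, n)) (B : 'M[R]_(n, p)) (C : 'M[R]_(p, q)) :
  `|A *m B *m C| <= (p%:R * n%:R * `|A| * `|C|) * `|B|.
Proof.
rewrite (le_trans (mx_norm_mul_le _ _))//.
have -> : p%:R * n%:R * `|A| * `|C| * `|B|
  = p%:R * (n%:R * (`|A| * `|B|) * `|C|) by ring.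
by rewrite ler_wpM2l// ler_wpM2r// mx_norm_mul_le.
Qed.

(** * Isolation of low-rank perturbations of a tight Gram matrix *)

(** If [X = Phi^T Phi + E] has the rank [m] of [Phi] and [E] is small, then
    [Phi X] is still row free, so that [X = W Phi X] for some [W].  Multiplying
    by [K] on both sides kills [Phi^T Phi] and leaves
    [K E K = (K W) (Phi E K)], where both factors are of first order in [E]. *)
Lemma compression_quadratic (R : realType) m n (Phi : 'M[R]_(m, n))
    (K : 'M[R]_n) (t : R) :
  0 < t -> Phi *m Phi^T = t%:M -> K *m Phi^T = 0 -> Phi *m K = 0 ->
  exists c delta, [/\ 0 <= c, 0 < delta &
    forall E, \rank (Phi^T *m Phi + E)%R = m -> `|E| <= delta ->
      `|K *m E *m K| <= c * `|E| ^+ 2].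
Proof.
move=> t0 PP KP PK.
pose P := n%:R * n%:R * `|Phi| * `|Phi^T|.
pose Q := n%:R * n%:R * `|K| * `|Phi^T|.
pose S := n%:R * n%:R * `|Phi| * `|K|.
have P0 : 0 <= P by rewrite !mulr_ge0.
have Q0 : 0 <= Q by rewrite !mulr_ge0.
have S0 : 0 <= S by rewrite !mulr_ge0.
pose T := t ^+ 2; have T0 : 0 < T by rewrite exprn_gt0.
have mP0 : 0 <= m%:R * P by rewrite mulr_ge0.
exists (m%:R * (2 / T * Q) * S), (T / 2 / (m%:R * P + 1)).
split; first by rewrite !mulr_ge0// invr_ge0 ltW.
  by rewrite !divr_gt0// ltr_wpDl.
move=> E rkX Ed; set X := Phi^T *m Phi + E in rkX.
(* The radius is chosen so that multiplying by the perturbation of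
   [Phi X Phi^T] costs at most half of its main term [t ^+ 2]. *)
have half l (V : 'M[R]_(l, m)) :
    `|V *m (Phi *m E *m Phi^T)| <= T / 2 * `|V|.
  rewrite (le_trans (mx_norm_mul_le _ _))//.
  rewrite mulrCA mulrC ler_wpM2r//.
  apply: (@le_trans _ _ (m%:R * (P * `|E|))).
    by rewrite ler_wpM2l// mx_norm_mul3_le.
  rewrite mulrA; move: Ed; rewrite ler_pdivlMr ?ltr_wpDl// => Ed.
  by apply: le_trans Ed; rewrite mulrC ler_wpM2l// lerDl.
have MX : Phi *m X *m Phi^T = T%:M + Phi *m E *m Phi^T.
  by rewrite mulmxDr mulmxDl mulmxA PP -mulmxA PP -scalar_mxM.
(* A quantitative inverse of [Phi X Phi^T]: the perturbation is absorbed in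
   the left-hand side. *)
have absorb l (V : 'M[R]_(l, m)) (Y : 'M[R]_(l, m)) :
    V *m (Phi *m X *m Phi^T) = Y -> `|V| <= 2 / T * `|Y|.
  rewrite MX mulmxDr mul_mx_scalar => /(congr1 (fun Z => `|Z|)) VY.
  have := half l V; have := ler_normB (T *: V + V *m (Phi *m E *m Phi^T))
    (V *m (Phi *m E *m Phi^T)).
  rewrite addrK VY mx_normZ gtr0_norm// => h1 h2.
  rewrite mulrAC ler_pdivlMr//; lra.
have free : row_free (Phi *m X).
  rewrite -kermx_eq0; apply/eqP; set V := kermx _.
  have /absorb : V *m (Phi *m X *m Phi^T) = 0.
    by rewrite mulmxA mulmx_ker mul0mx.
  by rewrite normr0 mulr0 normr_le0 => /eqP.
have /submxP[W XW] : (X <= Phi *m X)%MS.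
  by rewrite -(geq_leqif (mxrank_leqif_sup (submxMl Phi X))) (eqP free) rkX.
have KX : K *m X = K *m E by rewrite mulmxDr mulmxA KP mul0mx add0r.
have XK : Phi *m X *m K = Phi *m E *m K.
  by rewrite mulmxDr mulmxDl mulmxA -!mulmxA PK !mulmx0 add0r.
have KE : K *m E *m K = (K *m W) *m (Phi *m E *m K).
  by rewrite -KX -XK {1}XW !mulmxA.
have V1 : `|K *m W| <= 2 / T * (Q * `|E|).
  apply: le_trans (absorb _ _ (K *m E *m Phi^T) _) _.
    by rewrite -KX [in RHS]XW !mulmxA.
  by rewrite ler_wpM2l ?mx_norm_mul3_le// divr_ge0// ltW.
rewrite KE (le_trans (mx_norm_mul_le _ _))//.
have -> : m%:R * (2 / T * Q) * S * `|E| ^+ 2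
  = m%:R * ((2 / T * (Q * `|E|)) * (S * `|E|)) by ring.
by rewrite ler_wpM2l// ler_pM// mx_norm_mul3_le.
Qed.

(** A linear bound by [K E K] on a constraint set [F] and the quadratic bound
    coming from the rank are incompatible for small [E != 0]. *)
Lemma isolated_of_linear_bound (R : realType) m n (Phi : 'M[R]_(m, n))
    (K : 'M[R]_n) (t c : R) (F : set 'M[R]_n) :
  0 < t -> Phi *m Phi^T = t%:M -> K *m Phi^T = 0 -> Phi *m K = 0 -> 0 <= c ->
  (forall E, F (Phi^T *m Phi + E) -> `|E| <= c * `|K *m E *m K|) ->
  exists2 N : set 'M[R]_n, nbhs (gram Phi) N &
    forall X, N X -> \rank X = m -> F X -> X = gram Phi.
Proof.
move=> t0 PP KP PK c0 Fc.
have [c' [delta [c'0 d0 quad]]] := compression_quadratic t0 PP KP PK.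
pose r := Num.min delta (c * c' + 1)^-1.
have cc0 : 0 <= c * c' by rewrite mulr_ge0.
exists (ball (gram Phi) r).
  by apply: nbhsx_ballx; rewrite lt_min d0 invr_gt0 ltr_wpDl.
move=> X; rewrite mx_norm_ball /ball_/= -normrN opprB => Er rkX FX.
pose E := X - gram Phi; rewrite -/E in Er.
have XE : X = Phi^T *m Phi + E by rewrite /E /gram addrC subrK.
rewrite XE in rkX FX.
have /Fc E1 := FX.
move: Er; rewrite lt_min => /andP[/ltW Ed].
rewrite -[ltRHS]div1r ltr_pdivlMr ?ltr_wpDl// => Er.
have E2 : `|E| <= c * c' * `|E| ^+ 2.
  by rewrite (le_trans E1)// -mulrA ler_wpM2l// quad.
have : `|E| <= 0.
  rewrite leNgt; apply/negP => E0.
  suff : `|E| * 1 < `|E| * 1 by rewrite ltxx.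
  by rewrite {1}mulr1 (le_lt_trans E2)// expr2 mulrA mulrC ltr_pM2l//; lra.
by rewrite normr_le0 /E subr_eq0 => /eqP.
Qed.

(** * First-order information on the nonzero entries *)

(** [G / 2] is an orthogonal projection, hence so is [1 - G / 2], and the trace
    of the compression is the trace of [E (1 - G / 2)]. *)
Lemma tr_compression (R : realType) n (G E : 'M[R]_n) :
  G^T = G -> G *m G = 2 *: G -> (forall i, E i i = 0) ->
  \tr ((1%:M - 2^-1 *: G) *m E *m (1%:M - 2^-1 *: G))
    = - 2^-1 * \sum_i \sum_j E i j * G i j.
Proof.
move=> Gsym GG E0; set K := 1%:M - _.
have KK : K *m K = K.
  rewrite /K mulmxBl mul1mx mulmxBr mulmx1 -scalemxAl -scalemxAr GG.
  by rewrite !scalerA divfK// subrr subr0.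
rewrite -mulmxA mxtrace_mulC -mulmxA KK /K mulmxBr mulmx1 raddfB/=.
rewrite {1}/mxtrace big1// sub0r -scalemxAr mxtraceZ mulNr; congr (- (_ * _)).
apply: eq_bigr => i _; rewrite mxE; apply: eq_bigr => j _.
by rewrite -{1}Gsym mxE.
Qed.

(** Where [|G i j| = beta] the constraint makes [E i j * G i j] nonpositive;
    the trace of the compression is then a sum of nonnegative terms, one of
    which is proportional to [|E i j|]. *)
Lemma contact_entry_bound (R : realType) n (G E : 'M[R]_n) (beta : R) :
  G^T = G -> G *m G = 2 *: G ->
  (forall i j, i != j -> G i j = 0 \/ `|G i j| = beta) ->
  (forall i, E i i = 0) -> `|G + E - 1%:M| <= beta ->
  forall i j, i != j -> G i j != 0 ->
  beta * `|E i j|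
    <= 2 * \tr ((1%:M - 2^-1 *: G) *m E *m (1%:M - 2^-1 *: G)).
Proof.
move=> Gsym GG Gb E0 Xb i j ij Gij.
rewrite tr_compression// mulrA mulrN divff// mulN1r.
have b0 : 0 <= beta by apply: le_trans Xb.
have contact k l : k != l -> G k l != 0 -> beta * `|E k l| = - (E k l * G k l).
  move=> kl Gkl; have [G0|Gkb] := Gb k l kl; first by rewrite G0 eqxx in Gkl.
  have := le_trans (entry_le_mx_norm _ k l) Xb.
  rewrite !mxE (negbTE kl) subr0 -Gkb.
  have [g0|g0] := leP 0 (G k l).
    rewrite (ger0_norm g0) ler_norml => /andP[_ h].
    by rewrite ler0_norm; [ring|lra].
  rewrite (ltr0_norm g0) ler_norml opprK => /andP[h _].
  by rewrite ger0_norm; [ring|lra].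
have term_ge0 k l : 0 <= - (E k l * G k l).
  have [->|kl] := eqVneq k l; first by rewrite E0 mul0r oppr0.
  have [->|Gkl] := eqVneq (G k l) 0; first by rewrite mulr0 oppr0.
  by rewrite -contact// mulr_ge0.
rewrite contact// (bigD1 i)//= (bigD1 j)//= !opprD -!sumrN -addrA lerDl.
rewrite addr_ge0// sumr_ge0// => k _.
by rewrite -sumrN sumr_ge0// => l _; exact: term_ge0.
Qed.

(** * The Gram matrix of the rotated frame *)

Definition biangular_gram (R : realType) n (C : 'M[R]_n) (a b : R) :
    'M[R]_(n + n) :=
  block_mx (1%:M + a *: C) (- (b *: C)) (- (b *: C)) (1%:M - a *: C).

(** This makes the zeros of [G] rigid.  The upper right block of the compression
    is, up to the factor 4,
      [b^2 C D C + (1 - a C) D (1 + a C) = D - a (C D - D C)]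
    where [a^2 = b^2] cancels the terms in [C D C]; the commutator vanishes on
    the diagonal because [C] does. *)
Lemma compression_orthogonal_pair (R : realType) n (C : 'M[R]_n) (d : 'rV[R]_n)
    (a b : R) i :
  (forall i, C i i = 0) -> a ^+ 2 = b ^+ 2 ->
  let K := 1%:M - 2^-1 *: biangular_gram C a b in
  (K *m block_mx 0 (diag_mx d) (diag_mx d) 0 *m K) (lshift n i) (rshift n i)
    = 4^-1 * d 0 i.
Proof.
move=> C0 ab /=; set K := 1%:M - _.
have -> : K = 2^-1 *:
    block_mx (1%:M - a *: C) (b *: C) (b *: C) (1%:M + a *: C).
  rewrite /K /biangular_gram [1%:M]scalar_mx_block !scale_block_mx.
  rewrite opp_block_mx add_block_mx; congr block_mx; apply/matrixP => k l;
    rewrite !mxE; lra.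
rewrite -!(scalemxAl, scalemxAr) scalerA [LHS]mxE.
rewrite !mulmx_block !mulmx0 !addr0 !add0r block_mxEur.
set D := diag_mx _.
have -> : b *: C *m D *m (b *: C) + (1%:M - a *: C) *m D *m (1%:M + a *: C)
    = D - a *: (C *m D - D *m C).
  rewrite !mulmxDr !mulmxDl !mulmx1 !mul1mx !mulNmx.
  rewrite -!(scalemxAl, scalemxAr) !scalerA -!expr2 ab.
  apply/matrixP => k l; rewrite !mxE; ring.
rewrite /D mul_mx_diag mul_diag_mx !mxE eqxx mulr1n C0; lra.
Qed.

Lemma biangular_gram_sym (R : realType) n (C : 'M[R]_n) (a b : R) :
  C^T = C -> (biangular_gram C a b)^T = biangular_gram C a b.
Proof.
move=> Csym; have Cs i j : C j i = C i j by rewrite -{1}Csym mxE.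
by rewrite tr_block_mx; congr block_mx; apply/matrixP => i j;
  rewrite !mxE Cs// eq_sym.
Qed.

Lemma biangular_gram_sqr (R : realType) n (C : 'M[R]_n) (a b : R) :
  C *m C = 1%:M -> a ^+ 2 + b ^+ 2 = 1 ->
  biangular_gram C a b *m biangular_gram C a b = 2 *: biangular_gram C a b.
Proof.
move=> CC ab1; rewrite mulmx_block scale_block_mx.
rewrite !mulmxDl !mulmxDr !mulNmx !mulmxN !mulmx1 !mul1mx.
rewrite -!(scalemxAl, scalemxAr) CC !scalerA -!expr2.
have b2 : b ^+ 2 = 1 - a ^+ 2 by lra.
by rewrite b2; congr block_mx; apply/matrixP => k l; rewrite !mxE; ring.
Qed.

Lemma biangular_gram_diag (R : realType) n (C : 'M[R]_n) (a b : R) i :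
  (forall i, C i i = 0) -> biangular_gram C a b i i = 1.
Proof.
move=> C0; rewrite /biangular_gram.
case: (split_ordP i) => j ->; rewrite ?block_mxEul ?block_mxEdr !mxE.
all: by rewrite eqxx C0 mulr0 ?oppr0 addr0.
Qed.

Lemma biangular_gram_offdiag (R : realType) n (C : 'M[R]_n) (a b mu : R) i j :
  (forall i, C i i = 0) -> (forall i j, i != j -> `|C i j| = mu) ->
  a ^+ 2 = b ^+ 2 -> i != j ->
  biangular_gram C a b i j = 0 \/ `|biangular_gram C a b i j| = `|a| * mu.
Proof.
move=> C0 Cmu /eqP; rewrite eqf_sqr => ab.
have {}ab : `|b| = `|a| by case/orP: ab => /eqP ->; rewrite ?normrN.
rewrite /biangular_gram.
case: (split_ordP i) => k ->; case: (split_ordP j) => l ->;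
  rewrite ?(inj_eq (@lshift_inj _ _)) ?(inj_eq (@rshift_inj _ _)) => kl;
  rewrite ?block_mxEul ?block_mxEur ?block_mxEdl ?block_mxEdr !mxE.
- by right; rewrite (negbTE kl) add0r normrM Cmu.
- have [->|{}kl] := eqVneq k l; first by left; rewrite C0 mulr0 oppr0.
  by right; rewrite normrN normrM Cmu// ab.
- have [->|{}kl] := eqVneq k l; first by left; rewrite C0 mulr0 oppr0.
  by right; rewrite normrN normrM Cmu// ab.
- by right; rewrite (negbTE kl) add0r normrN normrM Cmu.
Qed.

Lemma subE (R : zmodType) m n (A B : 'M[R]_(m, n)) i j :
  (A - B) i j = A i j - B i j.
Proof. by rewrite !mxE. Qed.

(** The zeros of [G] off the diagonal are the pairs [(i, n + i)] and
    [(n + i, i)], so what is left of [E] after removing these entries is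
    controlled by its entries at the nonzero entries of [G]. *)
Lemma dist_orthogonal_pairs (R : realType) n (C : 'M[R]_n) (a b r : R)
    (E : 'M[R]_(n + n)) (d : 'rV[R]_n) :
  (forall i, C i i = 0) -> (forall i j, i != j -> C i j != 0) ->
  a != 0 -> b != 0 ->
  E^T = E -> (forall i, E i i = 0) -> 0 <= r ->
  (forall i j, i != j -> biangular_gram C a b i j != 0 -> `|E i j| <= r) ->
  (forall i, E (lshift n i) (rshift n i) = d 0 i) ->
  `|E - block_mx 0 (diag_mx d) (diag_mx d) 0| <= r.
Proof.
move=> C0 C_neq0 a0 b0 Esym E0 r0 contact Elr.
have Erl i : E (rshift n i) (lshift n i) = d 0 i.
  by rewrite -{1}Esym mxE.
have G_neq0 k : k != 0 -> forall i j, i != j -> k * C i j != 0.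
  by move=> k0 i j ij; rewrite mulf_neq0// C_neq0.
have zero_entry i j : (0 : 'M[R]_n) i j = 0 by rewrite mxE.
apply: mx_norm_le => // i j; rewrite subE.
have := contact i j; rewrite /biangular_gram.
case: (split_ordP i) => k ->; case: (split_ordP j) => l ->;
  rewrite ?(inj_eq (@lshift_inj _ _)) ?(inj_eq (@rshift_inj _ _))
    ?eq_lrshift ?eq_rlshift
    ?block_mxEul ?block_mxEur ?block_mxEdl ?block_mxEdr ?zero_entry
    ?[diag_mx d k l]mxE => Er;
  have [kl|kl] := eqVneq k l; rewrite ?mulr1n ?mulr0n ?subr0.
- by rewrite kl E0 normr0.
- by apply: Er => //; rewrite !mxE (negbTE kl) add0r G_neq0.
- by rewrite kl Elr subrr normr0.
- by apply: Er => //; rewrite !mxE oppr_eq0 G_neq0.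
- by rewrite kl Erl subrr normr0.
- by apply: Er => //; rewrite !mxE oppr_eq0 G_neq0.
- by rewrite kl E0 normr0.
- by apply: Er => //; rewrite !mxE (negbTE kl) add0r oppr_eq0 G_neq0.
Qed.

Lemma scalar_mxE (R : pzRingType) n (a : R) i j :
  (a%:M : 'M[R]_n) i j = a *+ (i == j).
Proof. by rewrite mxE. Qed.

(** The entries of [E] at the nonzero entries of [G] are bounded by the trace of
    [K E K].  Subtracting them changes [K E K] by a comparable amount, so the
    remaining part [F] of [E], supported on the zeros of [G], has a compression
    of the same order, from which its entries can be read off. *)
Lemma biangular_gram_rigid (R : realType) n (C : 'M[R]_n) (a b mu : R) :
  let G := biangular_gram C a b in let K := 1%:M - 2^-1 *: G in
  C^T = C -> C *m C = 1%:M -> (forall i, C i i = 0) ->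
  (forall i j, i != j -> `|C i j| = mu) -> 0 < mu ->
  a ^+ 2 = b ^+ 2 -> a ^+ 2 + b ^+ 2 = 1 ->
  exists2 c, 0 <= c & forall E, E^T = E -> (forall i, E i i = 0) ->
    `|G + E - 1%:M| <= `|G - 1%:M| -> `|E| <= c * `|K *m E *m K|.
Proof.
move=> G K Csym CC C0 Cmu mu0 ab ab1.
pose beta := `|a| * mu.
have a0 : a != 0.
  apply/eqP => a0; move: ab1; rewrite -ab a0 expr0n addr0 => /eqP.
  by rewrite eq_sym oner_eq0.
have b0 : b != 0 by rewrite -sqrf_eq0 -ab sqrf_eq0.
have beta0 : 0 < beta by rewrite mulr_gt0// normr_gt0.
have C_neq0 i j : i != j -> C i j != 0.
  by move=> ij; rewrite -normr_eq0 Cmu// gt_eqF.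
have Gsym : G^T = G by exact: biangular_gram_sym.
have GG : G *m G = 2 *: G by exact: biangular_gram_sqr.
have G1 i : G i i = 1 by exact: biangular_gram_diag.
have Gb i j : i != j -> G i j = 0 \/ `|G i j| = beta.
  exact: biangular_gram_offdiag.
have Gbeta : `|G - 1%:M| <= beta.
  apply: mx_norm_le => [|i j]; first exact: ltW.
  rewrite subE scalar_mxE; have [->|ij] := eqVneq i j.
    by rewrite G1 mulr1n subrr normr0 ltW.
  by rewrite mulr0n subr0; case: (Gb _ _ ij) => [->|->//]; rewrite normr0 ltW.
pose N : R := (n + n)%:R; have N0 : 0 <= N by exact: ler0n.
(* [s0] is the factor lost on the nonzero entries of [G] and [kappa] the norm of
   the map [Y |-> K Y K]. *)
pose s0 := 2 * N / beta.
have s0_ge0 : 0 <= s0 by apply: divr_ge0; [rewrite mulr_ge0|exact: ltW].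
pose kappa := N * N * `|K| * `|K|.
have kappa0 : 0 <= kappa by rewrite !mulr_ge0.
exists (s0 + 4 * (1 + kappa * s0)).
  by rewrite addr_ge0// mulr_ge0// addr_ge0// mulr_ge0.
move=> E Esym E0 XG.
set e := `|K *m E *m K|; have e0 : 0 <= e by exact: normr_ge0.
have tre : \tr (K *m E *m K) <= N * e.
  rewrite (le_trans (ler_norm _))// (le_trans (ler_norm_sum _ _ _))//.
  rewrite (le_trans (ler_sum _ (G := fun=> e) _))//.
    by move=> i _; exact: entry_le_mx_norm.
  by rewrite sumr_const card_ord mulr_natl.
have contact i j : i != j -> G i j != 0 -> `|E i j| <= s0 * e.
  move=> ij Gij.
  have /(_ _ _ ij Gij) := contact_entry_bound Gsym GG Gb E0 (le_trans XG Gbeta).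
  rewrite -/K => h; rewrite /s0 mulrAC ler_pdivlMr// mulrC.
  by rewrite (le_trans h)// -mulrA ler_wpM2l.
pose d := \row_i E (lshift n i) (rshift n i).
pose F := block_mx 0 (diag_mx d) (diag_mx d) 0.
have r0 : 0 <= s0 * e by rewrite mulr_ge0.
have EF : `|E - F| <= s0 * e.
  apply: (dist_orthogonal_pairs C0 C_neq0 a0 b0 Esym E0 r0 contact) => i.
  by rewrite mxE.
have dle i : `|d 0 i| <= 4 * (e + kappa * (s0 * e)).
  have dE : d 0 i = 4 * (K *m F *m K) (lshift n i) (rshift n i).
    by rewrite compression_orthogonal_pair// mulrA divff// mul1r.
  rewrite dE normrM ger0_norm// ler_wpM2l//.
  rewrite (le_trans (entry_le_mx_norm _ _ _))//.
  have -> : K *m F *m K = K *m E *m K - K *m (E - F) *m K.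
    by rewrite (mulmxBr K E) (mulmxBl (K *m E)) opprB addrC subrK.
  rewrite (le_trans (ler_normB _ _))// lerD2l.
  rewrite (le_trans (mx_norm_mul3_le _ _ _))//.
  by rewrite ler_wpM2l.
have Fle : `|F| <= 4 * (e + kappa * (s0 * e)).
  have q0 : 0 <= 4 * (e + kappa * (s0 * e)).
    by rewrite mulr_ge0// addr_ge0// mulr_ge0// mulr_ge0.
  apply: mx_norm_le => // i j; rewrite /F.
  case: (split_ordP i) => k ->; case: (split_ordP j) => l ->;
  rewrite ?block_mxEul ?block_mxEur ?block_mxEdl ?block_mxEdr !mxE ?normr0//;
  case: eqVneq => _; rewrite ?mulr1n ?normr0//.
  by have := dle k; rewrite mxE.
  by have := dle k; rewrite mxE.
rewrite -[E in leLHS](subrK F) (le_trans (ler_normD _ _))//.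
have -> : (s0 + 4 * (1 + kappa * s0)) * e
  = s0 * e + 4 * (e + kappa * (s0 * e)) by ring.
exact: lerD.
Qed.

(** * Trigonometry and Naimark complements *)

Lemma sin_intMpi (R : realType) (k : int) : sin (k%:~R * pi : R) = 0.
Proof.
have sin_natMpi n : sin (n%:R * pi : R) = 0.
  elim: n => [|n IHn]; first by rewrite mul0r sin0.
  by rewrite -natr1 mulrDl mul1r sinDpi IHn oppr0.
by case: k => n; rewrite ?NegzE ?mulrNz ?mulNr ?sinN ?sin_natMpi ?oppr0.
Qed.

(** The difference of the squares is [cos (4 theta)], and [4 theta] is an odd
    multiple of [pi / 2]. *)
Lemma cos2_eq_sin2_pi8 (R : realType) (theta : R) :
  (exists k : int, theta = (2 * k + 1)%:~R * (pi / 8)) ->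
  cos (theta + theta) ^+ 2 = sin (theta + theta) ^+ 2.
Proof.
move=> [k ->]; set x := _ * (pi / 8); apply/eqP; rewrite -subr_eq0.
rewrite !expr2 -cosD.
have -> : (x + x) + (x + x) = k%:~R * pi + pi / 2.
  by rewrite /x rmorphD rmorphM/=; field.
by rewrite cosDpihalf sin_intMpi oppr0.
Qed.

(** The stacked matrix [U] satisfies [U U^T = t], the common norm being read off
    from [A]; as [U] has full row rank, a left inverse of [U] turns this into
    [U^T U = t]. *)
Lemma naimark_gram (R : realType) d n t (A B : 'M[R]_(d, n)) : (0 < d)%N ->
  t != 0 -> A *m A^T = t%:M -> is_naimark_complement A B ->
  [/\ A *m B^T = 0, B *m A^T = 0, B *m B^T = t%:M &
      A^T *m A + B^T *m B = t%:M].
Proof.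
move=> d0 t0 AA [[_ /row_fullP[L LU]] orth eqnorm].
set U := col_mx A B in LU orth eqnorm.
have UU : U *m U^T = t%:M.
  apply/matrixP => i j; rewrite [RHS]mxE.
  have [<-|ij] := eqVneq i j; last by rewrite orth.
  rewrite mulr1n (eqnorm _ (lshift d (Ordinal d0))) tr_col_mx mul_col_row.
  by rewrite block_mxEul AA mxE eqxx.
have UtU : U^T *m U = t%:M.
  rewrite -[U^T]mul1mx -LU -(mulmxA L) UU mul_mx_scalar.
  by rewrite -scalemxAl LU scalemx1.
move: UtU; rewrite tr_col_mx mul_row_col => ->.
move: UU; rewrite tr_col_mx mul_col_row scalar_mx_block.
by move=> /eq_block_mx[_ -> -> ->].
Qed.

Lemma gram_psd (R : realType) m n (Phi : 'M[R]_(m, n)) :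
  positive_semidefinite (gram Phi).
Proof.
move=> x; rewrite /gram mulmxA -trmx_mul -mulmxA mxE.
by apply: sumr_ge0 => i _; rewrite mxE -expr2 sqr_ge0.
Qed.

Lemma gram_diag (R : realType) m n (Phi : 'M[R]_(m, n)) i :
  gram Phi i i = \sum_k Phi k i ^+ 2.
Proof. by rewrite mxE; apply: eq_bigr => k _; rewrite mxE. Qed.

Lemma rank_gram (R : realType) m n t (Phi : 'M[R]_(m, n)) :
  t != 0 -> Phi *m Phi^T = t%:M -> \rank (gram Phi) = m.
Proof.
move=> t0 PP; have free : row_free Phi.
  apply/row_freeP; exists (t^-1 *: Phi^T).
  by rewrite -scalemxAr PP scale_scalar_mx mulVf.
by rewrite mxrankMfree// mxrank_tr (eqP free).
Qed.

(** * The rotated frame *)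

Definition rotated_frame (R : realType) d n (A B : 'M[R]_(d, n)) (theta : R) :
    'M[R]_(d + d, n + n) :=
  block_mx (cos theta *: A) (- (sin theta *: A))
           (sin theta *: B) (cos theta *: B).

Lemma tr_rotated_frame (R : realType) d n (A B : 'M[R]_(d, n)) (theta : R) :
  (rotated_frame A B theta)^T =
  block_mx (cos theta *: A^T) (sin theta *: B^T)
           (- (sin theta *: A^T)) (cos theta *: B^T).
Proof.
by rewrite tr_block_mx; congr block_mx; apply/matrixP => i j; rewrite !mxE.
Qed.

Lemma gram_rotated_frame (R : realType) d n (A B : 'M[R]_(d, n)) (theta : R) :
  A^T *m A + B^T *m B = 2%:M ->
  gram (rotated_frame A B theta) = biangular_gram (A^T *m A - 1%:M)
    (cos (theta + theta)) (sin (theta + theta)).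
Proof.
move=> AB; rewrite /gram tr_rotated_frame mulmx_block.
rewrite !mulNmx !mulmxN -!(scalemxAl, scalemxAr) !scalerA -!expr2 opprK.
have -> : B^T *m B = 2%:M - A^T *m A by rewrite -AB addrAC subrr add0r.
rewrite /biangular_gram cosD sinD -!expr2.
have s2 : sin theta ^+ 2 = 1 - cos theta ^+ 2.
  by have := cos2Dsin2 theta; lra.
set P := A^T *m A; rewrite s2; congr block_mx; apply/matrixP => i j;
  rewrite !mxE; case: (i == j); rewrite ?mulr1n ?mulr0n; ring.
Qed.

Lemma rotated_frame_mul_tr (R : realType) d n (A B : 'M[R]_(d, n))
    (theta t : R) :
  A *m A^T = t%:M -> A *m B^T = 0 -> B *m A^T = 0 -> B *m B^T = t%:M ->
  rotated_frame A B theta *m (rotated_frame A B theta)^T = t%:M.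
Proof.
move=> AA AB BA BB; rewrite tr_rotated_frame mulmx_block.
rewrite !mulNmx !mulmxN opprK -!(scalemxAl, scalemxAr) AA AB BA BB.
rewrite !scaler0 ?oppr0 !addr0 !scalerA -!scalerDl -!expr2 cos2Dsin2 addrC.
by rewrite cos2Dsin2 !scale1r -scalar_mx_block.
Qed.

Theorem corollary16 (R : realType) (d : nat) (A B : 'M[R]_(d, 2 * d))
    (theta : R) (hd : (0 < d)%N) (hA : is_ETF A)
    (hB : is_naimark_complement A B)
    (htheta : exists k : int, theta = (2 * k + 1)%:~R * (pi / 8)) :
  let Phi : 'M[R]_(d + d, 2 * d + 2 * d) :=
    block_mx (cos theta *: A) (- (sin theta *: A))
             (sin theta *: B) (cos theta *: B) in
  [/\ is_orthobiangular Phi, is_tight_frame Phi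
    & strongly_locally_optimal Phi].
Proof.
move=> Phi; move: hA => [[A1 AA] Aeq].
have ratio e : (0 < e)%N -> (2 * e)%:R / e%:R = 2 :> R.
  by move=> e0; rewrite natrM mulfK// pnatr_eq0 -lt0n.
rewrite ratio// in AA.
have two0 : 2 != 0 :> R by [].
have [AB BA BB AABB] := naimark_gram hd two0 AA hB.
pose C := A^T *m A - 1%:M.
pose a := cos (theta + theta); pose b := sin (theta + theta).
have ab : a ^+ 2 = b ^+ 2 by exact: cos2_eq_sin2_pi8.
have ab1 : a ^+ 2 + b ^+ 2 = 1 by exact: cos2Dsin2.
have GE : gram Phi = biangular_gram C a b by exact: gram_rotated_frame.
have PP : Phi *m Phi^T = 2%:M by exact: rotated_frame_mul_tr.
have Csym : C^T = C by rewrite /C raddfB/= trmx_mul trmxK trmx1.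
have CC : C *m C = 1%:M.
  have A4 : A^T *m A *m (A^T *m A) = 2 *: (A^T *m A).
    by rewrite mulmxA -(mulmxA _ A) AA mul_mx_scalar -scalemxAl.
  rewrite mulmxBl mulmxBr mulmx1 mul1mx A4.
  by apply/matrixP => i j; rewrite !mxE; ring.
have C0 i : C i i = 0.
  by rewrite mxE -/(gram A) gram_diag A1 !mxE eqxx subrr.
have Cgram i j : i != j -> C i j = gram A i j.
  by move=> ij; rewrite !mxE (negbTE ij) subr0.
have n0 : (0 < 2 * d)%N by rewrite muln_gt0.
pose i0 := Ordinal n0.
(* Some off-diagonal entry of [C] is nonzero, for otherwise [C = 0], against
   [C^2 = 1]; equiangularity spreads this to all of them. *)
have [j0 ij0 Cij0] : exists2 j, i0 != j & C i0 j != 0.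
  have : (C *m C) i0 i0 = 1 by rewrite CC mxE eqxx.
  apply: contraPP => noj; rewrite mxE big1 => [|j _].
    by apply/eqP; rewrite eq_sym oner_eq0.
  have [<-|ij] := eqVneq i0 j; first by rewrite C0 mul0r.
  suff -> : C i0 j = 0 by rewrite mul0r.
  by apply: contra_notP noj => /eqP Cij; exists j.
pose mu := `|C i0 j0|; have mu0 : 0 < mu by rewrite normr_gt0.
have Cmu i j : i != j -> `|C i j| = mu.
  by move=> ij; rewrite /mu !Cgram//; exact: Aeq.
have G1 i : gram Phi i i = 1 by rewrite GE biangular_gram_diag.
have packing : is_packing Phi by move=> j; rewrite -gram_diag G1.
split.
- split=> //; exists (`|a| * mu) => [|i j ij]; first by rewrite mulr_ge0// ltW.
  rewrite GE; have [->|] := biangular_gram_offdiag C0 Cmu ab ij.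
    exact: Or31.
  by move/eqP; rewrite eqr_norml => /andP[/orP[]/eqP-> _];
    [exact: Or32|exact: Or33].
- split=> //; rewrite PP; congr (_%:M).
  by rewrite !addnn -mul2n -(mul2n d) ratio// muln_gt0.
have [c c0 rigid] := biangular_gram_rigid Csym CC C0 Cmu mu0 ab ab1.
rewrite -GE in rigid.
set K := 1%:M - 2^-1 *: gram Phi in rigid.
have KP : K *m Phi^T = 0.
  rewrite mulmxBl mul1mx -scalemxAl /gram -mulmxA PP mul_mx_scalar scalerA.
  by rewrite mulVf// scale1r subrr.
have PK : Phi *m K = 0.
  rewrite mulmxBr mulmx1 -scalemxAr /gram mulmxA PP mul_scalar_mx scalerA.
  by rewrite mulVf// scale1r subrr.
have Gsym : (gram Phi)^T = gram Phi by rewrite GE biangular_gram_sym.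
split=> //.
  by split=> //; [exact: gram_psd|exact: rank_gram PP].
pose F : set 'M[R]_(2 * d + 2 * d) := [set X | [/\ X^T = X,
  forall i, X i i = 1 & `|X - 1%:M| <= `|gram Phi - 1%:M| ] ]%classic.
have Fc E : F (Phi^T *m Phi + E) -> `|E| <= c * `|K *m E *m K|.
  rewrite -/(gram Phi) => -[Xsym X1 Xle]; apply: rigid => //.
    by move: Xsym; rewrite raddfD/= Gsym => /addrI.
  move=> i; have := X1 i.
    by rewrite mxE G1 => /(canRL (addKr _)); rewrite addNr.
have [N GN isolated] := isolated_of_linear_bound (ltr0Sn _ 1) PP KP PK c0 Fc.
exists N => // X [[[Xsym X1 _ rkX] NX] /= XG].
by rewrite ltNge; apply/negP => Xle; apply: XG; exact: isolated.
Qed.
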